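(* Let $\hat{\mathcal G}=(\mathcal V,\hat{\mathcal E})$ be a connected graph with positive line susceptances, and let $\mathcal G_e=(\mathcal V,\mathcal E_e)$ with $\mathcal E_e\subseteq\hat{\mathcal E}$ be a connected (existing) network. Let $z\in\{0,1\}^{|\hat{\mathcal E}|}$ with $z_\ell=1$ for all $\ell\in\mathcal E_e$, and let $X$ satisfy $\tilde L(z)X=I_N$. Then for every $\epsilon>0$ and all $i,j\in\mathcal V_r$ with $j\neq i$, $$X_{ij}\ \ge\ \frac{[\tilde L_f^{-1}]_{ii}+[\tilde L_f^{-1}]_{jj}-d_{ij}-\epsilon}{2},$$ where $d_{ij}$ is the sum of the reactances along the shortest path between $i$ and $j$ on $\mathcal G_e$.
   Context: The node set is $\mathcal V=\{1,\dots,N+1\}$, node $1$ is the reference node, and $\mathcal V_r=\mathcal V\setminus\{1\}$; $N\times N$ matrices and vectors of length $N$ are indexed by $\mathcal V_r$. Graphs are undirected; each line $(i,j)\in\hat{\mathcal E}$ has susceptance $b_{ij}>0$ and reactance $x_{ij}=b_{ij}^{-1}$, and path lengths are measured by the sum of the reactances of their lines. For $i\in\mathcal V_r$ let $e_i\in\mathbb R^N$ be the canonical vector, with $e_1=0$ for the reference node; for a line $(i,j)$ let $a_{ij}=e_i-e_j$. For a binary line-selection vector $z$ (with $z_\ell=1$ iff line $\ell$ is selected), the reduced susceptance Laplacian is $\tilde L(z)=\sum_{(i,j)\in\hat{\mathcal E}}z_{ij}b_{ij}a_{ij}a_{ij}^\top$. The matrix $\tilde L_f=\sum_{(i,j)\in\hat{\mathcal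 E}}b_{ij}a_{ij}a_{ij}^\top$ is the reduced Laplacian with all candidate lines selected. The setting is that of augmenting an existing network: all lines of $\mathcal E_e$ are kept and additional lines are selected from $\hat{\mathcal E}\setminus\mathcal E_e$. *)

(* Defs.v *)
From mathcomp Require Import all_boot all_order all_algebra.

Set Implicit Arguments.
Unset Strict Implicit.
Unset Printing Implicit Defensive.

Import Order.TTheory GRing.Theory Num.Theory.
Local Open Scope ring_scope.

Record sgraph (T : finType) := SGraph {
  adj :> rel T;
  adj_sym : symmetric adj;
  adj_irrefl : irreflexive adj
}.

Definition connected_graph (T : finType) (G : sgraph T) : Prop :=
  forall u v : T, connect G u v.

(* The nodes are 'I_N.+1 and ord0 is the reference node; an index k : 'I_N of a
   reduced vector or matrix stands for the non-reference node [node k]. *)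
Definition node (N : nat) (k : 'I_N) : 'I_N.+1 := lift ord0 k.

Definition evec (R : realFieldType) (N : nat) (u : 'I_N.+1) : 'cV[R]_N :=
  if unlift ord0 u is Some k then delta_mx k 0 else 0.

Definition avec (R : realFieldType) (N : nat) (u v : 'I_N.+1) : 'cV[R]_N :=
  evec R u - evec R v.

(* Each undirected line is counted once, through its representative (u, v) with
   u < v; the summands do not depend on this orientation when b and z are
   symmetric. *)
Definition red_laplacian (R : realFieldType) (N : nat) (G : sgraph 'I_N.+1)
    (b : 'I_N.+1 -> 'I_N.+1 -> R) (z : rel 'I_N.+1) : 'M[R]_N :=
  \sum_(l : 'I_N.+1 * 'I_N.+1 | (l.1 < l.2)%N && G l.1 l.2)
     ((z l.1 l.2)%:R * b l.1 l.2) *: (avec R l.1 l.2 *m (avec R l.1 l.2)^T).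

Definition red_laplacian_full (R : realFieldType) (N : nat)
    (G : sgraph 'I_N.+1) (b : 'I_N.+1 -> 'I_N.+1 -> R) : 'M[R]_N :=
  \sum_(l : 'I_N.+1 * 'I_N.+1 | (l.1 < l.2)%N && G l.1 l.2)
     b l.1 l.2 *: (avec R l.1 l.2 *m (avec R l.1 l.2)^T).

Definition reactance (R : realFieldType) (T : finType) (b : T -> T -> R)
    (u v : T) : R := (b u v)^-1.

(* The sequence p lists the nodes visited after the starting node u. *)
Fixpoint path_reactance (R : realFieldType) (T : finType) (b : T -> T -> R)
    (u : T) (p : seq T) : R :=
  if p is v :: q then reactance b u v + path_reactance b v q else 0.

Definition simple_path (T : finType) (G : sgraph T) (u v : T) (p : seq T) : bool :=
  [&& path G u p, last u p == v & uniq (u :: p)].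

Definition shortest_path (R : realFieldType) (T : finType) (G : sgraph T)
    (b : T -> T -> R) (u v : T) (p : seq T) : Prop :=
  simple_path G u v p /\
  forall q, simple_path G u v q -> path_reactance b u p <= path_reactance b u q.

Definition shortest_distance (R : realFieldType) (T : finType) (G : sgraph T)
    (b : T -> T -> R) (u v : T) (d : R) : Prop :=
  exists2 p, shortest_path G b u v p & d = path_reactance b u p.

Lemma shortest_distance_exists (R : realFieldType) (T : finType) (G : sgraph T)
    (b : T -> T -> R) (u v : T) :
  connected_graph G -> exists d, shortest_distance G b u v d.
Proof.
move=> conG.
pose P (t : {k : 'I_#|T|.+1 & k.-tuple T}) := simple_path G u v (tagged t).
pose F (t : {k : 'I_#|T|.+1 & k.-tuple T}) := path_reactance b u (tagged t).
have toP q : simple_path G u v q -> exists2 t, P t & tagged t = q :> seq T.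
  move=> sq; have /and3P[_ _ /= /andP[_ /card_uniqP szq]] := sq.
  have lt_sz : (size q < #|T|.+1)%N by rewrite ltnS -szq max_card.
  by exists (Tagged (fun k : 'I_#|T|.+1 => k.-tuple T)
               (in_tuple q : (Ordinal lt_sz).-tuple T)).
have /connectP[q0 q0P q0v] := conG u v.
case: (shortenP q0P) q0v => q1 q1P q1u _ q1v.
have [|t0 Pt0 _] := toP q1; first by rewrite /simple_path q1P -q1v eqxx.
case: (arg_minP F Pt0) => t Pt minF.
exists (F t), (tagged t) => //; split=> // q /toP[s Ps <-].
exact: minF.
Qed.

Lemma shortest_distance_unique (R : realFieldType) (T : finType) (G : sgraph T)
    (b : T -> T -> R) (u v : T) (d d' : R) :
  shortest_distance G b u v d -> shortest_distance G b u v d' -> d = d'.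
Proof.
move=> [p [sp minp] ->] [q [sq minq] ->].
by apply/eqP; rewrite eq_le minp // minq.
Qed.

(* Main.v *)
(** With [L := L(z)] and [X = L^-1], polarization gives
    [2 X_ij = X_ii + X_jj - a^T X a] for [a = e_i - e_j], so it suffices to show
    [X_ii >= (L_f^-1)_ii] (and likewise for [j]) and [a^T X a <= d].
    For the first, put [x = X e_i] and [f = L_f^-1 e_i]: since [L <= L_f] as
    quadratic forms,
    [0 <= (x - f)^T L (x - f) = X_ii - 2 f_i + f^T L f <= X_ii - f_i].
    For the second, read [y = X a] as a potential on the nodes:
    [D = a^T X a = y^T L y] is at once its drop from [i] to [j] and its energy.
    On each line [2 (y_u - y_v) <= 1 / b_uv + b_uv (y_u - y_v)^2]; summing along
    a simple path of existing lines gives [2 D <= d + D]. *)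
Require Import Defs.
From mathcomp Require Import all_boot all_order all_algebra ring lra.

Import Order.TTheory GRing.Theory Num.Theory.
Local Open Scope ring_scope.

Section WeightedLaplacian.
Set Implicit Arguments.
Unset Strict Implicit.

Context (R : realFieldType) (N : nat) (G : sgraph 'I_N.+1).
Implicit Types (w b : 'I_N.+1 -> 'I_N.+1 -> R) (x y : 'cV[R]_N).

(** Arbitrary weights let one family cover both matrices of the theorem: the weights [z * b] give
    [red_laplacian] and the weights [b] give [red_laplacian_full], both by conversion. *)
Definition wlap w : 'M[R]_N :=
  \sum_(l : 'I_N.+1 * 'I_N.+1 | (l.1 < l.2)%N && G l.1 l.2)
     w l.1 l.2 *: (avec R l.1 l.2 *m (avec R l.1 l.2)^T).

(** Extends a reduced vector to all nodes by grounding the reference node, since [evec] vanishes at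
    [ord0]. *)
Definition pot y (u : 'I_N.+1) : R := ((evec R u)^T *m y) 0 0.

Definition bform (A : 'M[R]_N) x y : R := (x^T *m A *m y) 0 0.

Lemma pot_node y (k : 'I_N) : pot y (node k) = y k 0.
Proof.
by rewrite /pot /evec /node liftK trmx_delta -rowE mxE.
Qed.

Lemma avec_pot y u v : (avec R u v)^T *m y = (pot y u - pot y v)%:M.
Proof.
by rewrite [LHS]mx11_scalar /avec linearB mulmxBl mxE [X in _ + X]mxE.
Qed.

Lemma tr_wlap w : (wlap w)^T = wlap w.
Proof.
rewrite /wlap linear_sum; apply: eq_bigr => l _.
by rewrite linearZ /= trmx_mul trmxK.
Qed.

Lemma wlap_mul w y :
  wlap w *m y = \sum_(l : 'I_N.+1 * 'I_N.+1 | (l.1 < l.2)%N && G l.1 l.2)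
     (w l.1 l.2 * (pot y l.1 - pot y l.2)) *: avec R l.1 l.2.
Proof.
rewrite mulmx_suml; apply: eq_bigr => l _.
by rewrite -scalemxAl -mulmxA avec_pot mul_mx_scalar scalerA.
Qed.

Lemma wlap_energy w y :
  bform (wlap w) y y =
  \sum_(l : 'I_N.+1 * 'I_N.+1 | (l.1 < l.2)%N && G l.1 l.2)
     w l.1 l.2 * (pot y l.1 - pot y l.2) ^+ 2.
Proof.
rewrite /bform -mulmxA wlap_mul mulmx_sumr summxE; apply: eq_bigr => l _.
rewrite -scalemxAr -[y^T *m _]trmxK trmx_mul trmxK avec_pot.
by rewrite tr_scalar_mx !mxE /= mulr1n -mulrA -expr2.
Qed.

Lemma ler_wlap w b y :
  (forall u v, G u v -> w u v <= b u v) ->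
  bform (wlap w) y y <= bform (wlap b) y y.
Proof.
move=> le_wb; rewrite !wlap_energy; apply: ler_sum => l /andP[_ Gl].
by rewrite ler_wpM2r ?sqr_ge0 ?le_wb.
Qed.

Lemma wlap_ge0 w y :
  (forall u v, G u v -> 0 <= w u v) -> 0 <= bform (wlap w) y y.
Proof.
move=> w_ge0; rewrite wlap_energy; apply: sumr_ge0 => l /andP[_ Gl].
by rewrite mulr_ge0 ?sqr_ge0 ?w_ge0.
Qed.

(* A vector of zero [b]-energy has no potential drop along any line of [G],
   hence lies in the kernel of the Laplacian for every weight [w]. *)
Lemma wlap_unitmx w b :
  (forall u v, G u v -> 0 < b u v) -> wlap w \in unitmx -> wlap b \in unitmx.
Proof.
move=> b_gt0 w_unit; rewrite -row_free_unit -kermx_eq0.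
apply/eqP/row_matrixP => k; rewrite row0.
set r := row k _; pose y := r^T.
have rb0 : r *m wlap b = 0 by apply/sub_kermxP; exact: row_sub.
have /eqP : bform (wlap b) y y = 0 by rewrite /bform trmxK rb0 mul0mx mxE.
rewrite wlap_energy psumr_eq0; last first.
  by move=> l /andP[_ Gl]; rewrite mulr_ge0 ?sqr_ge0 ?ltW ?b_gt0.
move=> /allP drop0.
have wy0 : wlap w *m y = 0.
  rewrite wlap_mul big1 // => l Pl.
  have := drop0 l (mem_index_enum l); rewrite Pl /= mulf_eq0 sqrf_eq0.
  have /andP[_ Gl] := Pl.
  by rewrite gt_eqF ?b_gt0 //= => /eqP ->; rewrite mulr0 scale0r.
by rewrite -[r]trmxK -/y -[y](mulKmx w_unit) wy0 mulmx0 trmx0.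
Qed.

Lemma bform_wlapB w x y :
  bform (wlap w) (x - y) (x - y) =
  bform (wlap w) x x - 2 * bform (wlap w) y x + bform (wlap w) y y.
Proof.
have bform_sym : bform (wlap w) x y = bform (wlap w) y x.
  have -> : bform (wlap w) x y = ((x^T *m wlap w *m y)^T) 0 0 by rewrite mxE.
  by rewrite !trmx_mul trmxK tr_wlap mulmxA.
have sub_entry (M M' : 'M[R]_1) : (M - M') 0 0 = M 0 0 - M' 0 0.
  by rewrite !mxE.
have -> : bform (wlap w) (x - y) (x - y) =
    bform (wlap w) x x - bform (wlap w) y x
    - (bform (wlap w) x y - bform (wlap w) y y).
  rewrite /bform [(x - y)^T]linearB /= mulmxBl mulmxBr !mulmxBl !sub_entry.
  ring.
rewrite bform_sym; ring.
Qed.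

Lemma bform_delta (A : 'M[R]_N) (x y : 'cV[R]_N) (k : 'I_N) :
  A *m x = delta_mx k 0 -> bform A y x = y k 0.
Proof. by rewrite /bform -mulmxA => ->; rewrite -colE !mxE. Qed.

Lemma invmx_wlap_diag_le w b (k : 'I_N) :
  (forall u v, G u v -> 0 <= w u v <= b u v) ->
  wlap w \in unitmx -> wlap b \in unitmx ->
  invmx (wlap b) k k <= invmx (wlap w) k k.
Proof.
move=> wb w_unit b_unit.
(* Columns of the inverses are treated as solutions of linear systems, so that [bform_delta] turns
   diagonal entries into values of the form. *)
have column (A : 'M[R]_N) : A \in unitmx ->
    exists2 x : 'cV_N, A *m x = delta_mx k 0 & invmx A k k = x k 0.
  by exists (col k (invmx A)); rewrite ?mxE // colE mulKVmx.
have [x wx ->] := column _ w_unit; have [f bf ->] := column _ b_unit.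
have ff : bform (wlap w) f f <= f k 0.
  by rewrite -[leRHS](bform_delta _ bf); apply: ler_wlap => u v /wb /andP[].
have : 0 <= bform (wlap w) (x - f) (x - f).
  by apply: wlap_ge0 => u v /wb /andP[].
rewrite bform_wlapB !(bform_delta _ wx); lra.
Qed.

(** Energy is measured with [w] and reactance with [b]. Since [w = b] on the path, the two are
    compared line by line, and the energy off the path is nonnegative. *)
Lemma path_drop_le w b y (u : 'I_N.+1) (p : seq 'I_N.+1) :
  (forall v v', w v v' = w v' v) ->
  (forall v v', G v v' -> 0 <= w v v') ->
  path (fun v v' => [&& G v v', 0 < b v v' & w v v' == b v v']) u p ->
  uniq (u :: p) ->
  2 * (pot y u - pot y (last u p)) <=
    path_reactance b u p + bform (wlap w) y y.
Proof.
move=> w_sym w_ge0 walk simple.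
pose c (l : 'I_N.+1 * 'I_N.+1) := w l.1 l.2 * (pot y l.1 - pot y l.2) ^+ 2.
pose line (l : 'I_N.+1 * 'I_N.+1) := (l.1 < l.2)%N && G l.1 l.2.
have c_ge0 l : line l -> 0 <= c l.
  by case/andP=> _ Gl; rewrite mulr_ge0 ?sqr_ge0 ?w_ge0.
(* The induction needs an energy that shrinks with the path: only lines with both ends in [s]
   count. *)
pose inner (s : seq 'I_N.+1) :=
  \sum_(l | line l && ((l.1 \in s) && (l.2 \in s))) c l.
(* Simplicity of the path makes its lines distinct: the first one does not lie
   within the nodes of the tail. *)
suff inner_le : 2 * (pot y u - pot y (last u p)) <=
    path_reactance b u p + inner (u :: p).
  apply: le_trans inner_le _; rewrite lerD2l wlap_energy.
  rewrite [leRHS](bigID (fun l => (l.1 \in u :: p) && (l.2 \in u :: p))) /=.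
  by rewrite lerDl sumr_ge0 // => l /andP[/c_ge0].
elim: p u walk simple => [|v q IHq] u /=.
  by move=> _ _; rewrite subrr mulr0 add0r sumr_ge0 // => l /andP[/c_ge0].
case/andP=> /and3P[Guv b_gt0 /eqP wb] walk /andP[u_notin simple].
have {IHq} := IHq v walk simple.
(* [uv] is whichever orientation of the first line the Laplacian sum counts; symmetry of [w] and the
   square make the choice harmless. *)
have [uv uv_line [c_uv uv_in uv_u]]: exists2 l, line l &
    [/\ c l = b u v * (pot y u - pot y v) ^+ 2,
        (l.1 \in [:: u, v & q]) && (l.2 \in [:: u, v & q])
      & (l.1 == u) || (l.2 == u)].
  have neq_uv : u != v by apply: contraNneq u_notin => ->; rewrite mem_head.
  case: (ltngtP u v) => [lt_uv|lt_vu|/val_inj/eqP];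
    last by rewrite (negPf neq_uv).
    by exists (u, v); rewrite /line /c /= ?lt_uv ?wb ?inE ?eqxx ?orbT.
  exists (v, u); first by rewrite /line /= lt_vu adj_sym.
  by rewrite /c /= w_sym wb -sqrrN opprB !inE !eqxx ?orbT.
have inner_cons : c uv + inner (v :: q) <= inner [:: u, v & q].
  rewrite {2}/inner (bigD1 uv) ?uv_line //= lerD2l.
  rewrite /inner big_mkcond [leRHS]big_mkcond; apply: ler_sum => l _ /=.
  case: ifP => [/andP[line_l /andP[l1_in l2_in]]|_].
    rewrite line_l !(in_cons u) l1_in l2_in !orbT /=.
    case: eqP => // l_uv; rewrite l_uv in l1_in l2_in.
    by case/orP: uv_u u_notin => /eqP <-; rewrite ?l1_in ?l2_in.
  by case: ifP => // /andP[/andP[/c_ge0]].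
have : 2 * (pot y u - pot y v) <=
    reactance b u v + b u v * (pot y u - pot y v) ^+ 2.
  (* Completing the square around the drop [1 / s], where equality holds. *)
  rewrite /reactance; set t := _ - _; set s := b u v in b_gt0 *.
  have : 0 <= s * (t - s^-1) ^+ 2 by rewrite mulr_ge0 ?sqr_ge0 ?ltW.
  have -> : s * (t - s^-1) ^+ 2 = s^-1 + s * t ^+ 2 - 2 * t.
    by field; rewrite gt_eqF.
  lra.
rewrite c_uv in inner_cons.
lra.
Qed.

End WeightedLaplacian.

Theorem lemma2 (R : realFieldType) (N : nat)
    (Ghat Ge : sgraph 'I_N.+1)
    (b : 'I_N.+1 -> 'I_N.+1 -> R)
    (b_sym : forall u v, b u v = b v u)
    (b_pos : forall u v, Ghat u v -> 0 < b u v)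
    (Ghat_connected : connected_graph Ghat)
    (Ge_sub : forall u v, Ge u v -> Ghat u v)
    (Ge_connected : connected_graph Ge)
    (z : rel 'I_N.+1)
    (z_sym : symmetric z)
    (z_existing : forall u v, Ge u v -> z u v)
    (X : 'M[R]_N)
    (X_inverse : red_laplacian Ghat b z *m X = 1%:M)
    (eps : R) (eps_pos : 0 < eps)
    (i j : 'I_N) (ij_neq : j != i)
    (d : R) (d_dist : shortest_distance Ge b (node i) (node j) d) :
  X i j >=
    ((invmx (red_laplacian_full Ghat b)) i i
     + (invmx (red_laplacian_full Ghat b)) j j - d - eps) / 2.
Proof.
pose w u v := (z u v)%:R * b u v.
have wb u v : Ghat u v -> 0 <= w u v <= b u v.
  move=> /b_pos/ltW b_ge0; rewrite /w.
  by case: (z u v); rewrite ?mul1r ?mul0r ?b_ge0 ?lexx.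
rewrite -[red_laplacian_full Ghat b]/(wlap Ghat b).
move: X_inverse; rewrite -[red_laplacian Ghat b z]/(wlap Ghat w) => WX.
have [w_unit _] := mulmx1_unit WX.
have X_inv : X = invmx (wlap Ghat w) by rewrite -[X](mulKmx w_unit) WX mulmx1.
have X_sym : X j i = X i j by rewrite X_inv -[in LHS]tr_wlap -trmx_inv mxE.
(* Invertibility passes from [L(z)] to [L_f]; on a singular matrix [invmx] would return the matrix
   itself. *)
have b_unit := wlap_unitmx b_pos w_unit.
have := invmx_wlap_diag_le i wb w_unit b_unit.
have := invmx_wlap_diag_le j wb w_unit b_unit.
rewrite -X_inv.
pose y := col i X - col j X.
have Wy : wlap Ghat w *m y = delta_mx i 0 - delta_mx j 0.
  by rewrite mulmxBr !colE !mulmxA WX !mul1mx.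
have energy : bform (wlap Ghat w) y y = y i 0 - y j 0.
  by rewrite /bform -mulmxA Wy mulmxBr -!colE !mxE.
have [p [/and3P[p_path /eqP p_last p_uniq] _] ->] := d_dist.
have walk : path (fun v v' => [&& Ghat v v', 0 < b v v' & w v v' == b v v'])
    (node i) p.
  apply: sub_path p_path => u v Guv.
  by rewrite Ge_sub // b_pos ?Ge_sub // /w z_existing // mul1r /=.
have w_sym u v : w u v = w v u by rewrite /w z_sym b_sym.
have w_ge0 u v : Ghat u v -> 0 <= w u v by case/wb/andP.
have := path_drop_le y w_sym w_ge0 walk p_uniq.
rewrite p_last !pot_node energy !mxE X_sym => drop le_j le_i.
(* [drop] now reads [2 * D <= d + D] with [D = X i i + X j j - 2 * X i j]. *)
rewrite ler_pdivrMr //; lra.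
Qed.
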